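(* If $X$ is a geodesic space, then $FS_n(X)$ is $2$-quasiconvex. Moreover, if $n\geq 3$, then the quasiconvexity constant $2$ for $FS_n(X)$ is the least; that is, $FS_n(X)$ is not $\lambda$-quasiconvex for any $1\leq\lambda<2$.
   Context: For a metric space $X=(X,d)$ and an integer $n\geq 1$, $FS_n(X)$ is the set of nonempty subsets of $X$ with at most $n$ elements, a metric space with the Hausdorff distance $d_H(A,B)=\max\{\max_{a\in A}\min_{b\in B}d(a,b),\ \max_{b\in B}\min_{a\in A}d(a,b)\}$. For $\lambda\geq1$, a path (continuous map) $\gamma:[0,1]\to Y$ in a metric space $Y$ is a $\lambda$-quasigeodesic if $d(\gamma(t),\gamma(t'))\leq\lambda d(\gamma(0),\gamma(1))|t-t'|$ for all $t,t'\in[0,1]$. $Y$ is $\lambda$-quasiconvex (with quasiconvexity constant $\lambda$) if every two points of $Y$ are connected by a $\lambda$-quasigeodesic in $Y$; $Y$ is geodesic if it is $1$-quasiconvex.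
   Formalization: In the ''moreover'' part, X is assumed to have at least two distinct points; if X is empty or a single point, FS_n(X) is empty or a single point, hence 1-quasiconvex, and the claim fails. *)

(* Defs.v *)
From HB Require Import structures.
From mathcomp Require Import all_boot all_order all_algebra finmap.
From mathcomp Require Import all_classical all_reals all_analysis.

Set Implicit Arguments.
Unset Strict Implicit.
Unset Printing Implicit Defensive.

Import Order.TTheory GRing.Theory Num.Theory.

Local Open Scope classical_set_scope.
Local Open Scope ring_scope.

(* A path [0, 1] -> Y is represented by a function on the whole of R, of which
   only the restriction to [0, 1] matters. *)
Definition is_path (R : realType) (Y : metricType R) (g : R -> Y) : Prop :=
  {within `[0, 1], continuous g}.

Definition quasigeodesic (R : realType) (Y : metricType R) (lam : R)
    (g : R -> Y) : Prop :=
  is_path g /\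
  forall t t' : R, 0 <= t <= 1 -> 0 <= t' <= 1 ->
    mdist (g t) (g t') <= lam * mdist (g 0) (g 1) * `|t - t'|.

Definition quasiconvex (R : realType) (lam : R) (Y : metricType R) : Prop :=
  forall x y : Y, exists g : R -> Y,
    [/\ quasigeodesic lam g, g 0 = x & g 1 = y].

Definition geodesic_space (R : realType) (Y : metricType R) : Prop :=
  quasiconvex 1 Y.

(* The sets are finite and nonempty where this is used, so that every inf is a
   min and every sup is a max (see inf_fset_attained, sup_fset_attained). *)
Definition hausdorff_dist (R : realType) (X : metricType R) (A B : {fset X}) : R :=
  Num.max (sup [set inf [set mdist a b | b in [set` B]] | a in [set` A]])
          (sup [set inf [set mdist a b | a in [set` A]] | b in [set` B]]).

Record FS (R : realType) (n : nat) (X : metricType R) := MkFS {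
  fset_of_FS :> {fset X};
  card_FS : (0 < #|` fset_of_FS| <= n)%N
}.

HB.instance Definition _ (R : realType) (n : nat) (X : metricType R) :=
  [isSub for @fset_of_FS R n X].
HB.instance Definition _ (R : realType) (n : nat) (X : metricType R) :=
  [Choice of FS n X by <:].

Section FiniteExtrema.
Variables (R : realType) (X : choiceType) (f : X -> R) (A : {fset X}).
Hypothesis A0 : (0 < #|` A|)%N.

Lemma inf_fset_attained : exists2 a, a \in A &
  inf [set f x | x in [set` A]] = f a /\ forall x, x \in A -> f a <= f x.
Proof.
move: A0; rewrite cardfs_gt0 => /fset0Pn[a0 a0A].
case: (@Order.TotalTheory.arg_minP _ _ _ [` a0A]%fset predT (f \o val) isT).
move=> i _ imin.
have fi x : x \in A -> f (val i) <= f x.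
  by move=> xA; exact: (imin [` xA]%fset).
exists (val i); [exact: valP|split => //].
apply/eqP; rewrite eq_le; apply/andP; split.
  by apply: ge_inf; [exists (f (val i)) => _ [x xA <-]; exact: fi
                    |exists (val i) => //; exact: valP].
apply: lb_le_inf; first by exists (f a0), a0.
by move=> _ [x xA <-]; exact: fi.
Qed.

Lemma sup_fset_attained : exists2 a, a \in A &
  sup [set f x | x in [set` A]] = f a /\ forall x, x \in A -> f x <= f a.
Proof.
move: A0; rewrite cardfs_gt0 => /fset0Pn[a0 a0A].
case: (@Order.TotalTheory.arg_maxP _ _ _ [` a0A]%fset predT (f \o val) isT).
move=> i _ imax.
have fi x : x \in A -> f x <= f (val i).
  by move=> xA; exact: (imax [` xA]%fset).
exists (val i); [exact: valP|split => //].
apply/eqP; rewrite eq_le; apply/andP; split.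
  apply: ge_sup; first by exists (f a0), a0.
  by move=> _ [x xA <-]; exact: fi.
by apply: ub_le_sup; [exists (f (val i)) => _ [x xA <-]; exact: fi
                     |exists (val i) => //; exact: valP].
Qed.

End FiniteExtrema.

Section HausdorffMetric.
Variables (R : realType) (X : metricType R).
Implicit Types A B C : {fset X}.

Lemma hausdorff_dist_leP A B (r : R) :
    (0 < #|` A|)%N -> (0 < #|` B|)%N ->
  hausdorff_dist A B <= r <->
  (forall a, a \in A -> exists2 b, b \in B & mdist a b <= r) /\
  (forall b, b \in B -> exists2 a, a \in A & mdist a b <= r).
Proof.
move=> A0 B0; rewrite /hausdorff_dist ge_max.
have [a1 a1A [-> a1max]] :=
  sup_fset_attained (fun a => inf [set mdist a b | b in [set` B]]) A0.
have [b1 b1B [-> b1max]] :=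
  sup_fset_attained (fun b => inf [set mdist a b | a in [set` A]]) B0.
split=> [/andP[ha hb]|[ha hb]].
  split=> [a aA|b bB].
    have [b bB [e _]] := inf_fset_attained (fun b => mdist a b) B0.
    by exists b => //; rewrite -e (le_trans (a1max _ aA)).
  have [a aA [e _]] := inf_fset_attained (fun a => mdist a b) A0.
  by exists a => //; rewrite -e (le_trans (b1max _ bB)).
apply/andP; split.
  have [b _ [-> bmin]] := inf_fset_attained (fun b => mdist a1 b) B0.
  by have [b' b'B] := ha _ a1A; apply: le_trans; exact: bmin.
have [a _ [-> amin]] := inf_fset_attained (fun a => mdist a b1) A0.
by have [a' a'A] := hb _ b1B; apply: le_trans; exact: amin.
Qed.

Variable n : nat.

Definition FS_dist (A B : FS n X) : R := hausdorff_dist A B.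

Let card_gt0 (A : FS n X) : (0 < #|` A|)%N.
Proof. by case/andP: (card_FS A). Qed.

Let FS_dist_leP (A B : FS n X) r :=
  @hausdorff_dist_leP _ _ r (card_gt0 A) (card_gt0 B).

Let FS_dist_ge0 (A B : FS n X) : 0 <= FS_dist A B.
Proof.
have [h _] := (FS_dist_leP A B _).1 (lexx _).
have := card_gt0 A; rewrite cardfs_gt0 => /fset0Pn[a /h[b _]].
by apply: le_trans; exact: mdist_ge0.
Qed.

Let FS_distxx (A : FS n X) : FS_dist A A = 0.
Proof.
apply/eqP; rewrite eq_le FS_dist_ge0 andbT.
by apply/FS_dist_leP; split=> a aA; exists a; rewrite // mdistxx.
Qed.

Let FS_dist_positivity (A B : FS n X) : FS_dist A B = 0 -> A = B.
Proof.
move=> AB0; have /FS_dist_leP[hA hB] : FS_dist A B <= 0 by rewrite AB0.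
have d0 (x y : X) : mdist x y <= 0 -> x = y.
  by move=> xy; apply: mdist_positivity; apply/eqP; rewrite eq_le xy mdist_ge0.
apply/val_inj/fsetP => x; apply/idP/idP.
  by move=> /hA[y yB /d0 ->].
by move=> /hB[y yA /d0 <-].
Qed.

Let FS_dist_sym (A B : FS n X) : FS_dist A B = FS_dist B A.
Proof.
suff le (C D : FS n X) : FS_dist C D <= FS_dist D C.
  by apply/eqP; rewrite eq_le !le.
have [hD hC] := (FS_dist_leP D C _).1 (lexx _).
apply/FS_dist_leP; split=> x.
  by move=> /hC[y yD xy]; exists y; rewrite // metric_sym.
by move=> /hD[y yC xy]; exists y; rewrite // metric_sym.
Qed.

Let FS_dist_triangle (B A C : FS n X) : FS_dist A C <= FS_dist A B + FS_dist B C.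
Proof.
have [hA hB] := (FS_dist_leP A B _).1 (lexx _).
have [hB' hC] := (FS_dist_leP B C _).1 (lexx _).
apply/FS_dist_leP; split.
  move=> a /hA[b /hB'[c cC bc] ab]; exists c => //.
  exact: le_trans (metric_triangle _ b _) (lerD ab bc).
move=> c /hC[b /hB[a aA ab] bc]; exists a => //.
exact: le_trans (metric_triangle _ b _) (lerD ab bc).
Qed.

HB.instance Definition _ := isMetric.Build R (FS n X)
  FS_distxx FS_dist_positivity FS_dist_sym FS_dist_triangle.

Lemma mdist_FSE (A B : FS n X) : mdist A B = hausdorff_dist A B.
Proof. by []. Qed.

End HausdorffMetric.

(* Main.v *)
Require Import Defs.
From HB Require Import structures.
From mathcomp Require Import all_boot all_order all_algebra finmap.
From mathcomp Require Import all_classical all_reals all_analysis.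
From mathcomp Require Import ring lra zify.

(** The constant 2 comes from a two-stage motion through a finite set C that
lies between A and B.

Upper bound.  Put D = d_H(A, B).  If every point a of A is sent to a point c a
at distance at most D, then moving all of A simultaneously along geodesics
from a to c a is a D-Lipschitz path in FS_n(X): at each time the set is an image
of A, hence has at most n elements (FS_lipschitz_path_to_image).  A single stage
of this kind cannot lead from A to B in general, since a point of A may have to
split while others have to merge.  However, A and B always have a common image
C = c(A) = c'(B) under maps that move no point by more than D
(FS_common_image): the points of A first merge into C, and then the points of C
split into B, which is the merging of B into C run backwards.  Running both
stages at double speed gives a 2D-Lipschitz path (lipschitz01_concat).

Optimality.  In a lam-quasiconvex space any two points at distance D > 0 have a
common neighbour at distance at most lam D / 2 from both
(quasiconvex_midpoint), which is less than D when lam < 2.  A geodesic segment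
of X contains points P_0, ..., P_2n with d(P_i, P_j) = delta |i - j|
(geodesic_grid).  Take
  A = {P_0, P_2, ..., P_(2n-4)} u {P_(2n-1)},
  B = {P_1} u {P_4, P_6, ..., P_2n}.
Both have n elements and d_H(A, B) <= delta, since P_0 and P_2 are neighbours of
P_1, while P_(2n-2) and P_2n are neighbours of P_(2n-1).  For n >= 3 each of the
n + 1 points P_0, P_2, ..., P_2n lies in A or in B, so a set C that is closer
than delta to both A and B has a point closer than delta to each of them.  As
these n + 1 points are 2 delta apart, C has more than n elements
(separated_near_card). *)

Set Implicit Arguments.
Unset Strict Implicit.
Unset Printing Implicit Defensive.

Local Open Scope classical_set_scope.
Local Open Scope ring_scope.

Import Order.TTheory GRing.Theory Num.Theory.

(** * Lipschitz paths on the unit interval *)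

Definition lipschitz01 (R : realType) (Y : metricType R) (L : R)
    (g : R -> Y) : Prop :=
  forall t t' : R, 0 <= t <= 1 -> 0 <= t' <= 1 ->
    mdist (g t) (g t') <= L * `|t - t'|.

Lemma lipschitz01_is_path (R : realType) (Y : metricType R) (L : R)
    (g : R -> Y) :
  lipschitz01 L g -> is_path g.
Proof.
move=> gL; apply/subspace_continuousP => x; rewrite /= in_itv /= => x01.
apply/metricType_numDomainType.cvgrPdist_lt => e e0.
(* L is arbitrary, so it is replaced by a positive upper bound to divide by. *)
have L1 : 0 < `|L| + 1 by rewrite ltr_wpDl.
rewrite near_withinE; near=> y; rewrite /= in_itv /= => y01.
apply: le_lt_trans (gL _ _ x01 y01) _.
have xy : `|x - y| < e / (`|L| + 1).
  by near: y; apply: cvgr_dist_lt => //; rewrite divr_gt0.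
rewrite ltr_pdivlMr // in xy; apply: le_lt_trans xy; rewrite mulrC.
by apply: ler_wpM2l => //; rewrite (le_trans (ler_norm L)) // lerDl.
Unshelve. all: by end_near.
Qed.

(** The second path is run backwards, because it will be the merging of the
target set into the intermediate set. *)
Lemma lipschitz01_concat (R : realType) (Y : metricType R) (L : R)
    (p q : R -> Y) :
    lipschitz01 L p -> lipschitz01 L q -> p 1 = q 1 ->
  exists g : R -> Y,
    [/\ lipschitz01 (2 * L) g, g 0 = p 0 & g 1 = q 0].
Proof.
move=> pL qL pq1.
(* Both formulas give p 1 = q 1 at t = 1 / 2. *)
pose g t := if t <= 1 / 2 then p (2 * t) else q (2 - 2 * t).
exists g; split; last first.
- by rewrite /g ifF; [congr q; lra|apply/negP; lra].
- by rewrite /g ifT; [congr p; lra|lra].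
move=> s t; wlog st : s t / s <= t => [H s01 t01|].
  have [st|/ltW ts] := leP s t; first exact: H.
  by rewrite metric_sym distrC; exact: H.
move=> /andP[s0 s1] /andP[t0 t1].
have -> : `|s - t| = t - s by rewrite distrC ger0_norm // subr_ge0.
rewrite /g; case: (leP s (1 / 2)) => hs; case: (leP t (1 / 2)) => ht.
- apply: le_trans (pL _ _ _ _) _; [lra|lra|].
  by rewrite distrC ger0_norm; lra.
(* Across the gluing time the two half estimates, taken through the common
   endpoint, add up. *)
- apply: le_trans (metric_triangle _ (p 1) _) _.
  have := pL (2 * s) 1 ltac:(lra) ltac:(lra).
  have := qL 1 (2 - 2 * t) ltac:(lra) ltac:(lra).
  rewrite -pq1 distrC (distrC (2 * s)) ler0_norm; last lra.
  by rewrite ger0_norm; lra.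
- by move: (le_lt_trans (le_trans st ht) hs); rewrite ltxx.
- apply: le_trans (qL _ _ _ _) _; [lra|lra|].
  by rewrite ger0_norm; lra.
Qed.

(** A choice of geodesics, so that all points of a finite set can be moved at
once. *)
Lemma geodesic_family (R : realType) (X : metricType R) :
    geodesic_space X ->
  exists G : X -> X -> R -> X, forall x y,
    [/\ lipschitz01 (mdist x y) (G x y), G x y 0 = x & G x y 1 = y].
Proof.
move=> geoX.
have h (xy : X * X) : exists g : R -> X,
    [/\ lipschitz01 (mdist xy.1 xy.2) g, g 0 = xy.1 & g 1 = xy.2].
  have [g [[_ gq] g0 g1]] := geoX xy.1 xy.2.
  exists g; split=> // s t s01 t01.
  by have := gq s t s01 t01; rewrite g0 g1 mul1r.
have [G GP] := choice h.
by exists (fun x y => G (x, y)) => x y; exact: (GP (x, y)).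
Qed.

(** * Moving finite sets *)

Section FiniteSubsets.
Variables (R : realType) (X : metricType R) (n : nat).
Implicit Types A B C : FS n X.

Lemma FS_card_gt0 A : (0 < #|` A|)%N.
Proof. by case/andP: (card_FS A). Qed.

Lemma FS_dist_leP A B (r : R) :
  mdist A B <= r <->
  (forall a, a \in fset_of_FS A ->
     exists2 b, b \in fset_of_FS B & mdist a b <= r) /\
  (forall b, b \in fset_of_FS B ->
     exists2 a, a \in fset_of_FS A & mdist a b <= r).
Proof. by rewrite mdist_FSE; apply: hausdorff_dist_leP; exact: FS_card_gt0. Qed.

Lemma card_FS_image (f : X -> X) A :
  (0 < #|` [fset f a | a in fset_of_FS A]%fset| <= n)%N.
Proof.
case/andP: (card_FS A); rewrite !cardfs_gt0 => /fset0Pn[a aA] An.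
apply/andP; split; last by apply: leq_trans An; exact: leq_imfset_card.
by apply/fset0Pn; exists (f a); exact: in_imfset.
Qed.

Definition FS_image (f : X -> X) A : FS n X := MkFS (card_FS_image f A).

Lemma FS_imageP (f : X -> X) A x :
  reflect (exists2 a, a \in fset_of_FS A & x = f a)
    (x \in fset_of_FS (FS_image f A)).
Proof. exact: imfsetP. Qed.

Lemma FS_image_id (f : X -> X) A :
  (forall a, a \in fset_of_FS A -> f a = a) -> FS_image f A = A.
Proof.
move=> fid; apply/val_inj/fsetP => x.
apply/(FS_imageP f A x)/idP => [[a aA ->]|xA]; first by rewrite fid.
by exists x; rewrite ?fid.
Qed.

Lemma FS_dist_image (f g : X -> X) A (r : R) :
    (forall a, a \in fset_of_FS A -> mdist (f a) (g a) <= r) ->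
  mdist (FS_image f A) (FS_image g A) <= r.
Proof.
move=> fg; apply/FS_dist_leP; split=> x /FS_imageP[a aA ->].
  by exists (g a); [apply/FS_imageP; exists a|exact: fg].
by exists (f a); [apply/FS_imageP; exists a|exact: fg].
Qed.

(** Let f : A -> B and g : B -> A choose points at distance at most
D = d_H(A, B).  The points b outside f(A) must be reached by splitting, so their
partners S = g(B \ f(A)) are kept fixed and every other point a of A merges into
f a.  Hence C = S u T with T = f(A \ S).  Conversely, B maps onto C: the
points of T stay, a point outside f(A) goes to its partner in S, and any
remaining b is f a for some a that must belong to S, and goes to that a. *)
Lemma FS_common_image A B :
  exists c c' : X -> X,
    [/\ FS_image c A = FS_image c' B,
        forall a, a \in fset_of_FS A -> mdist a (c a) <= mdist A B &
        forall b, b \in fset_of_FS B -> mdist b (c' b) <= mdist A B].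
Proof.
have [hA hB] := (FS_dist_leP A B _).1 (lexx _).
have /choice[f fP] : forall a, exists b, a \in fset_of_FS A ->
    b \in fset_of_FS B /\ mdist a b <= mdist A B.
  move=> a; case: (boolP (a \in fset_of_FS A)) => [/hA[b bB ab]|_].
    by exists b.
  by exists a.
have /choice[g gP] : forall b, exists a, b \in fset_of_FS B ->
    a \in fset_of_FS A /\ mdist a b <= mdist A B.
  move=> b; case: (boolP (b \in fset_of_FS B)) => [/hB[a aA ab]|_].
    by exists a.
  by exists b.
pose fA := [fset f a | a in fset_of_FS A]%fset.
pose S := [fset g b | b in (fset_of_FS B `\` fA)%fset]%fset.
pose c a := if a \in S then a else f a.
have cd a : a \in fset_of_FS A -> mdist a (c a) <= mdist A B.
  rewrite /c; case: ifP => [_ _|_ /fP[]//].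
  by rewrite mdistxx mdist_ge0.
pose T := [fset f a | a in (fset_of_FS A `\` S)%fset]%fset.
have /choice[c' c'P] : forall b, exists x, b \in fset_of_FS B ->
    [/\ x \in fset_of_FS (FS_image c A), mdist b x <= mdist A B,
        (b \in T -> x = b) & (b \notin fA -> x = g b)].
  move=> b; case: (boolP (b \in fset_of_FS B)) => [bB|_]; last by exists b.
  case: (boolP (b \in fA)) => [bfA|bfA].
    case: (boolP (b \in T)) => bT.
      exists b => _; split=> //; last by rewrite mdistxx mdist_ge0.
      case/imfsetP: bT => a /=; rewrite inE => /andP[aS aA] ->.
      by apply/FS_imageP; exists a => //; rewrite /c (negbTE aS).
    (* A preimage of b outside S would put b in T. *)
    case/imfsetP: (bfA) => a /= aA bE.
    have aS : a \in S.
      apply: contraNT bT => aS; rewrite bE; apply: in_imfset => /=.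
      by rewrite inE aS.
    exists a => _; split=> //.
      by apply/FS_imageP; exists a => //; rewrite /c aS.
    by rewrite metric_sym bE; case: (fP _ aA).
  have [gA gd] := gP _ bB.
  have gS : g b \in S by apply: in_imfset => /=; rewrite inE bfA.
  exists (g b) => _; split=> //.
  - by apply/FS_imageP; exists (g b) => //; rewrite /c gS.
  - by rewrite metric_sym.
  - move=> bT; move: bfA; case/imfsetP: bT => a /=.
    rewrite inE => /andP[_ aA] ->.
    by rewrite (_ : f a \in fA) //; exact: in_imfset.
exists c, c'; split=> //; last by move=> b /c'P[].
apply/val_inj/fsetP => x.
apply/(FS_imageP c A x)/(FS_imageP c' B x) => [[a aA ->]|[b /c'P[h _ _ _] ->]].
  rewrite /c; case: ifPn => aS.
    case/imfsetP: aS => b /=; rewrite inE => /andP[bfA bB] ->.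
    by exists b => //; case: (c'P _ bB) => _ _ _ ->.
  have [fB _] := fP _ aA.
  exists (f a) => //; case: (c'P _ fB) => _ _ -> //.
  by apply: in_imfset => /=; rewrite inE aS.
exact/FS_imageP.
Qed.

Lemma FS_lipschitz_path_to_image (c : X -> X) A (r : R) :
    geodesic_space X ->
    (forall a, a \in fset_of_FS A -> mdist a (c a) <= r) ->
  exists p : R -> FS n X,
    [/\ lipschitz01 r p, p 0 = A & p 1 = FS_image c A].
Proof.
move=> /geodesic_family[G GP] cr.
exists (fun t => FS_image (fun a => G a (c a) t) A); split.
- move=> s t s01 t01; apply: FS_dist_image => a aA.
  have [Gl _ _] := GP a (c a); apply: le_trans (Gl _ _ s01 t01) _.
  by apply: ler_wpM2r => //; exact: cr.
- by apply: FS_image_id => a _; case: (GP a (c a)).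
- by congr FS_image; apply/funext => a; case: (GP a (c a)).
Qed.

Lemma FS_quasiconvex2 : geodesic_space X -> quasiconvex 2 (FS n X).
Proof.
move=> geoX A B; have [c [c' [cc' cA cB]]] := FS_common_image A B.
have [p [pL p0 p1]] := FS_lipschitz_path_to_image geoX cA.
have [q [qL q0 q1]] := FS_lipschitz_path_to_image geoX cB.
have [|g [gL g0 g1]] := lipschitz01_concat pL qL.
  by rewrite p1 q1.
exists g; rewrite g0 g1 p0 q0; split=> //.
by split; [exact: lipschitz01_is_path gL|rewrite g0 g1 p0 q0].
Qed.

End FiniteSubsets.

(** * Optimality of the constant *)

Lemma quasiconvex_midpoint (R : realType) (Y : metricType R) (lam : R)
    (x y : Y) :
    quasiconvex lam Y ->
  exists z, mdist x z <= lam / 2 * mdist x y /\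
            mdist z y <= lam / 2 * mdist x y.
Proof.
move=> /(_ x y)[g [[_ gq] g0 g1]]; exists (g (1 / 2)).
split.
  have := gq 0 (1 / 2) ltac:(lra) ltac:(lra).
  by rewrite g0 g1 ler0_norm; lra.
have := gq (1 / 2) 1 ltac:(lra) ltac:(lra).
by rewrite g0 g1 ler0_norm; lra.
Qed.

(** Equality d(g s, g t) = L |s - t| on a geodesic g of length L follows from
the Lipschitz bounds on [0, s], [s, t] and [t, 1], whose sum is exactly L. *)
Lemma geodesic_grid (R : realType) (X : metricType R) (m : nat) :
    geodesic_space X -> (exists x y : X, x <> y) -> (0 < m)%N ->
  exists (delta : R) (P : nat -> X), 0 < delta /\
    forall i j, (i <= j <= m)%N -> mdist (P i) (P j) = delta * (j - i)%:R.
Proof.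
move=> geoX [x [y xy]] m0.
have [g [[_ gq] g0 g1]] := geoX x y.
set L := mdist x y; have L0 : 0 < L by rewrite mdist_gt0; apply/eqP.
have gE s t : 0 <= s -> s <= t -> t <= 1 -> mdist (g s) (g t) = L * (t - s).
  move=> s0 st t1; apply/eqP; rewrite eq_le; apply/andP; split.
    have := gq s t ltac:(lra) ltac:(lra).
    by rewrite g0 g1 mul1r distrC ger0_norm // subr_ge0.
  have h1 : mdist x (g s) <= L * s.
    have := gq 0 s ltac:(lra) ltac:(lra).
    by rewrite g0 g1 mul1r distrC subr0 ger0_norm.
  have h2 : mdist (g t) y <= L * (1 - t).
    have := gq t 1 ltac:(lra) ltac:(lra).
    by rewrite g0 g1 mul1r distrC ger0_norm // subr_ge0.
  have := metric_triangle x (g s) y.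
  have := metric_triangle (g s) (g t) y.
  rewrite -/L; lra.
have m0R : (0 : R) < m%:R by rewrite ltr0n.
exists (L / m%:R), (fun i => g (i%:R / m%:R)); split; first by rewrite divr_gt0.
move=> i j /andP[ij jm].
rewrite gE; first by rewrite natrB //; field; rewrite gt_eqF.
- by rewrite divr_ge0 // ler0n.
- by rewrite ler_pM2r ?invr_gt0 // ler_nat.
- by rewrite ler_pdivrMr // mul1r ler_nat.
Qed.

(** Points z i of C close to distinct q i are distinct, by the triangle
inequality. *)
Lemma separated_near_card (R : realType) (X : metricType R) (n : nat)
    (C : {fset X}) (q : nat -> X) (r : R) :
    (forall i j, (i < j < n)%N -> 2 * r <= mdist (q i) (q j)) ->
    (forall i, (i < n)%N -> exists2 z, z \in C & mdist (q i) z < r) ->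
  (n <= #|` C|)%N.
Proof.
move=> sep near.
have /choice[z zP] : forall i, exists z, (i < n)%N ->
    z \in C /\ mdist (q i) z < r.
  move=> i; case: (boolP (i < n)%N) => [/near[z zC zr]|_]; first by exists z.
  by exists (q i).
rewrite -{1}(size_iota 0 n) -(size_map z); apply: uniq_leq_size; last first.
  by move=> _ /mapP[i + ->]; rewrite mem_iota => /andP[_ /zP[]].
rewrite map_inj_in_uniq ?iota_uniq // => i j.
rewrite !mem_iota !add0n => /= i_n j_n.
wlog : i j i_n j_n / (i < j)%N.
  case: (ltngtP i j) => [ij|ji|//] H; first exact: H.
  by move=> /esym /(H _ _ j_n i_n ji).
move=> ij zz; exfalso.
have [_ h1] := zP i i_n; have [_ h2] := zP j j_n.
have : 2 * r <= mdist (q i) (q j) by apply: sep; rewrite ij.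
have := metric_triangle (q i) (z i) (q j).
rewrite (metric_sym (z i)) {2}zz.
by lra.
Qed.

Lemma FS_of_seq (R : realType) (X : metricType R) (n : nat) (s : seq X) :
  (0 < size s <= n)%N -> exists A : FS n X, fset_of_FS A =i s.
Proof.
move=> /andP[s0 sn].
have ss : (0 < #|` [fset x in s]%fset| <= n)%N.
  rewrite cardfs_gt0; apply/andP; split.
    case: s s0 {sn} => // x s _; apply/fset0Pn; exists x.
    by rewrite !inE eqxx.
  apply: leq_trans sn; apply: uniq_leq_size; first exact: fset_uniq.
  by move=> x; rewrite !inE.
by exists (MkFS ss) => x; rewrite /= !inE.
Qed.

Lemma FS_not_quasiconvex (R : realType) (X : metricType R) (n : nat) (lam : R) :
    geodesic_space X -> (exists x y : X, x <> y) -> (3 <= n)%N ->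
    0 <= lam -> lam < 2 ->
  ~ quasiconvex lam (FS n X).
Proof.
move=> geoX xy n3 lam0 lam2 qc.
have [delta [P [d0 PE]]] := geodesic_grid (m := 2 * n)%N geoX xy ltac:(lia).
have Psucc i j : (i <= j.+1)%N -> (j <= i.+1)%N ->
    (i <= 2 * n)%N -> (j <= 2 * n)%N -> mdist (P i) (P j) <= delta.
  wlog ij : i j / (i <= j)%N => [H|ij' ji i_n j_n].
    by case: (leqP i j) => [|/ltnW] ij *; [|rewrite metric_sym]; apply: H.
  rewrite PE ?ij //; rewrite -[leRHS]mulr1 ler_pM2l // -[1]/(1%:R) ler_nat.
  by lia.
have [A AE] : exists A : FS n X, fset_of_FS A =i
    P (2 * n - 1)%N :: [seq P (2 * i)%N | i <- iota 0 (n - 1)].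
  by apply: FS_of_seq; rewrite /= size_map size_iota; lia.
have [B BE] : exists B : FS n X, fset_of_FS B =i
    P 1%N :: [seq P (2 * i)%N | i <- iota 2 (n - 1)].
  by apply: FS_of_seq; rewrite /= size_map size_iota; lia.
have evenA i : (i < n - 1)%N -> P (2 * i)%N \in fset_of_FS A.
  move=> hi; rewrite AE inE; apply/orP; right.
  by apply/mapP; exists i; rewrite // mem_iota.
have evenB i : (2 <= i <= n)%N -> P (2 * i)%N \in fset_of_FS B.
  move=> hi; rewrite BE inE; apply/orP; right.
  by apply/mapP; exists i; rewrite // mem_iota; lia.
have oddA : P (2 * n - 1)%N \in fset_of_FS A by rewrite AE inE eqxx.
have oddB : P 1%N \in fset_of_FS B by rewrite BE inE eqxx.
have AB : mdist A B <= delta.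
  apply/FS_dist_leP; split=> x.
    rewrite AE inE => /orP[/eqP->|/mapP[i]].
      by exists (P (2 * n)%N); [apply: evenB; lia|apply: Psucc; lia].
    rewrite mem_iota => hi ->; case: (leqP i 1) => i1.
      by exists (P 1%N) => //; apply: Psucc; lia.
    by exists (P (2 * i)%N); [apply: evenB; lia|apply: Psucc; lia].
  rewrite BE inE => /orP[/eqP->|/mapP[i]].
    by exists (P (2 * 0)%N); [apply: evenA; lia|apply: Psucc; lia].
  rewrite mem_iota => hi ->; case: (ltnP i (n - 1)) => i1.
    by exists (P (2 * i)%N); [apply: evenA; lia|apply: Psucc; lia].
  by exists (P (2 * n - 1)%N) => //; apply: Psucc; lia.
have [C [AC CB]] := quasiconvex_midpoint A B qc.
have lt_delta : lam / 2 * mdist A B < delta.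
  have : lam / 2 * mdist A B <= lam / 2 * delta by apply: ler_wpM2l => //; lra.
  have : lam / 2 * delta < 1 * delta by rewrite ltr_pM2r //; lra.
  by lra.
have /FS_dist_leP[nearA _] := AC; have /FS_dist_leP[_ nearB] := CB.
have : (n.+1 <= #|` fset_of_FS C|)%N.
  apply: (separated_near_card (q := fun i => P (2 * i)%N) (r := delta)).
    move=> i j ij; rewrite PE; last lia.
    by rewrite mulrC ler_pM2l // -[2]/(2%:R) ler_nat; lia.
  move=> i i_n; case: (ltnP i (n - 1)) => i1.
    have [z zC zd] := nearA _ (evenA _ i1).
    by exists z => //; exact: le_lt_trans lt_delta.
  have [z zC zd] := nearB (P (2 * i)%N) (evenB i ltac:(lia)).
  by exists z => //; rewrite metric_sym; exact: le_lt_trans lt_delta.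
by case/andP: (card_FS C) => _ Cn; rewrite ltnNge Cn.
Qed.

Theorem theorem4p8 (R : realType) (X : metricType R) (n : nat)
    (n_ge1 : (1 <= n)%N) (geoX : geodesic_space X) :
  quasiconvex 2 (FS n X) /\
  ((3 <= n)%N -> (exists x y : X, x <> y) ->
   forall lam : R, 1 <= lam -> lam < 2 -> ~ quasiconvex lam (FS n X)).
Proof.
split; first exact: FS_quasiconvex2.
move=> n3 xy lam lam1 lam2; apply: FS_not_quasiconvex => //.
exact: le_trans lam1.
Qed.
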